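(* Let $b\ge 2$ be an integer, let $X$ be a Pareto random variable with minimum value $x_{\mathrm m}>0$ and shape parameter $s>0$, and put $\rho=\{\log_b x_{\mathrm m}\}$. Let $\mathbf{A}_k=[A_1,\ldots,A_k]$, $k\ge 1$, be the first $k$ coefficients (excluding $A_0$) of the simple continued fraction $\log_b X=[A_0;A_1,A_2,\ldots]$. Then for every $\mathbf{a}_k=[a_1,\ldots,a_k]\in\mathbb{N}^k$, $$\begin{aligned}\Pr(\mathbf{A}_k=\mathbf{a}_k)=(-1)^k\Big(&b^{s(\rho-1)}\,\frac{b^{-s[0;\mathbf{a}_k]}-b^{-s[0;\mathbf{a}_k+\mathbf{e}_k]}}{1-b^{-s}}\\&+u\big([0;\mathbf{a}_k+\mathbf{e}_k]-\rho\big)\big(1-b^{-s([0;\mathbf{a}_k+\mathbf{e}_k]-\rho)}\big)\\&-u\big([0;\mathbf{a}_k]-\rho\big)\big(1-b^{-s([0;\mathbf{a}_k]-\rho)}\big)\Big).\end{aligned}$$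
   Context: $\mathbb{N}$ excludes zero. A Pareto random variable with minimum value $x_{\mathrm m}$ and shape parameter $s$ has probability density function $f_X(x)=s\,x_{\mathrm m}^s\,x^{-(s+1)}$ for $x\ge x_{\mathrm m}$ (and $0$ otherwise). $\{z\}=z-\lfloor z\rfloor$ is the fractional part, and $u$ is the unit-step function: $u(z)=1$ if $z\ge0$ and $u(z)=0$ otherwise. With $Y_0=\log_b X$, the continued fraction coefficients are defined by $Y_j=\{Y_{j-1}\}^{-1}$ and $A_j=\lfloor Y_j\rfloor$ for $j\ge1$ (almost surely well defined). $\mathbf{e}_k=[0,\ldots,0,1]$ is the $k$-vector with a one in position $k$ and zeros elsewhere. $[0;\mathbf{a}_k]=[0;a_1,\ldots,a_k]$ denotes the finite simple continued fraction $\cfrac{1}{a_1+\cfrac{1}{a_2+\cdots+\cfrac{1}{a_k}}}$, and so $[0;\mathbf{a}_k+\mathbf{e}_k]=[0;a_1,\ldots,a_{k-1},a_k+1]$. *)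

(* Defs.v *)
From HB Require Import structures.
From mathcomp Require Export all_boot all_order all_algebra.
From mathcomp Require Export all_classical all_reals all_analysis.

Set Implicit Arguments.
Unset Strict Implicit.
Unset Printing Implicit Defensive.

Import Order.TTheory GRing.Theory Num.Theory.
Import numFieldNormedType.Exports.

Local Open Scope classical_set_scope.
Local Open Scope ring_scope.

Definition pareto_pdf (R : realType) (xm s x : R) : R :=
  if xm <= x then s * xm `^ s * x `^ (- (s + 1)) else 0.

Definition is_pareto d (T : measurableType d) (R : realType)
    (P : probability T R) (X : {RV P >-> R}) (xm s : R) : Prop :=
  forall B : set R, measurable B ->
    distribution P X B =
    (\int[lebesgue_measure]_(x in B) (pareto_pdf xm s x)%:E)%E.

Definition logb (R : realType) (b : nat) (x : R) : R := ln x / ln b%:R.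

Definition frac (R : realType) (z : R) : R := z - (Num.floor z)%:~R.

Definition unit_step (R : realType) (z : R) : R := if 0 <= z then 1 else 0.

(* Complete quotients. If the expansion of y terminates, so that some          *)
(* frac (cf_Y y j) is 0, then the convention 0^-1 = 0 makes all later cf_Y and  *)
(* cf_A vanish; hence no spurious positive coefficient is created.             *)
Fixpoint cf_Y (R : realType) (y : R) (j : nat) : R :=
  if j is i.+1 then (frac (cf_Y y i))^-1 else y.

Definition cf_A (R : realType) (y : R) (j : nat) : int := Num.floor (cf_Y y j).

(* [A_1, ..., A_k]: rows are indexed from 0, and A_0 is left out. *)
Definition cf_coeffs (R : realType) (k : nat) (y : R) : 'rV[int]_k :=
  \row_(j < k) cf_A y j.+1.

(* [0; a_1, ..., a_k]; the empty tail contributes 0, so [0; a_1] = 1 / a_1. *)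
Definition cf_eval (R : realType) (k : nat) (a : 'rV[nat]_k) : R :=
  foldr (fun c t : R => (c + t)^-1) 0 [seq (a ord0 j)%:R | j <- enum 'I_k].

Definition e_last (k : nat) : 'rV[nat]_k := \row_(j < k) (j.+1 == k : nat).

(* Main.v *)
Require Import Defs.
From mathcomp Require Import measurable_realfun ring lra.
Set Implicit Arguments.
Unset Strict Implicit.
Unset Printing Implicit Defensive.
Import Order.TTheory GRing.Theory Num.Theory.
Import numFieldNormedType.Exports.
Local Open Scope classical_set_scope.
Local Open Scope ring_scope.

(** Write c = [0; a_1, ..., a_k] and c' = [0; a_1, ..., a_k + 1].  Whether the
    coefficients A_1, ..., A_k of y are a_1, ..., a_k depends only on the
    fractional part of y.  The map t |-> [0; a_1, ..., a_k + t] is monotone on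
    [0, 1], increasing or decreasing with the parity of k, and runs from c at
    t = 0 to c' at t = 1; t is the fractional part of the k-th complete quotient.
    So the event says that the fractional part lies between c and c'.  This is
    where the factor (-1)^k comes from: it orients the interval.  Only the
    endpoints are delicate (for instance [0; 2] = [0; 1, 1], whose coefficients
    are read in one way only), so the event is merely sandwiched between the open
    interval (between_cf_starts) and the closed one (cf_starts_between), which is
    enough for a law without atoms.

    On the side of probability, put l = log_b xm: then log_b X - l is exponential,
    P(log_b X >= y) = P(log_b X > y) = b^(-s (y - l)) for y >= l
    (logb_tail_ge, logb_tail_gt).  Cut the real line into the unit cells
    [m + n, m + n + 1[ with m = floor l, so that l = m + rho.  The cells below m
    are null.  In the cell n = 0 the tail is truncated at rho, and this gives the
    two unit-step terms.  The cells n >= 1 lie beyond l, and contribute a geometric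
    series of ratio b^(-s), whose sum is the term with denominator 1 - b^(-s)
    (prob_frac_near_itv). *)

(** * Cylinders of continued fractions *)

(** [0; l_1, ..., l_k + t].  For positive entries and 0 < t < 1 it is the number
    whose expansion starts with l and whose k-th complete quotient has fractional
    part t; the values t = 0 and t = 1 give the endpoints of the cylinder of l. *)
Definition cf_tail (R : realType) (l : seq nat) (t : R) : R :=
  foldr (fun c t : R => (c + t)^-1) t [seq c%:R | c <- l].

(** The entries of l are the first coefficients of z, here including floor z.  The
    expansion of y without its coefficient 0 is that of (frac y)^-1, and this shift
    makes induction on l possible. *)
Fixpoint cf_starts (R : realType) (l : seq nat) (z : R) : Prop :=
  if l is c :: l' then Num.floor z = c%:Z /\ cf_starts l' (frac z)^-1
  else True.

Lemma frac_itv (R : realType) (y : R) : 0 <= frac y < 1.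
Proof.
have := floor_itv y; rewrite intrD /frac => /andP[h1 h2].
by apply/andP; split; lra.
Qed.

Lemma fracE (R : realType) (y : R) (m : int) :
  m%:~R <= y < m%:~R + 1 -> frac y = y - m%:~R.
Proof. by move=> h; rewrite /frac (@floor_def _ y m) // intrD. Qed.

Lemma cf_tail_itv (R : realType) (l : seq nat) (t : R) :
  all (leq 1) l -> 0 <= t <= 1 -> 0 <= cf_tail l t <= 1.
Proof.
move=> + t01; elim: l => //= c l IH /andP[c0 /IH].
rewrite /cf_tail /= -/(cf_tail l t) => /andP[l0 l1].
have c1 : 1 <= c%:R :> R by rewrite ler1n.
rewrite invr_ge0 invf_le1; lra.
Qed.

(** One step of the expansion, t |-> 1 / (c + t), reverses the order.  Writing
    this as an equality with a positive factor D lets the sign (-1)^k be carried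
    through an induction. *)
Lemma invr_sub_signed (R : realType) (c u v : R) : 0 < c + u -> 0 < c + v ->
  exists2 D : R, 0 < D & (c + u)^-1 - (c + v)^-1 = D * (v - u).
Proof.
move=> cu cv; exists ((c + u) * (c + v))^-1; first by rewrite invr_gt0 mulr_gt0.
by field; rewrite !gt_eqF.
Qed.

Lemma cf_tail_order (R : realType) (l : seq nat) :
  all (leq 1) l -> 0 <= (-1) ^+ size l * (cf_tail l 1 - cf_tail l 0) :> R.
Proof.
elim: l => [_|c l IH /= /andP[c0 l0]]; first by rewrite /cf_tail /=; lra.
have c1 : 1 <= c%:R :> R by rewrite ler1n.
have /andP[u0 _] := @cf_tail_itv R l 1 l0 ltac:(lra).
have /andP[v0 _] := @cf_tail_itv R l 0 l0 ltac:(lra).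
rewrite /cf_tail /= -!/(cf_tail l _) exprS.
case: (@invr_sub_signed R c%:R (cf_tail l 1) (cf_tail l 0)); [lra..|].
move=> D D0 ->; have := IH l0; set e := (-1) ^+ _ => /(mulr_ge0 (ltW D0)).
by lra.
Qed.

(** The sign (-1)^k puts [0; l] on the left and [0; l, with last entry + 1] on the
    right in both parities: this says that frac y is weakly between them.  One
    reversal of order per coefficient accounts for the sign. *)
Lemma cf_starts_between (R : realType) (l : seq nat) (y : R) :
  all (leq 1) l -> cf_starts l (frac y)^-1 ->
  0 <= (-1) ^+ size l * (frac y - cf_tail l 0) /\
  0 <= (-1) ^+ size l * (cf_tail l 1 - frac y).
Proof.
elim: l y => [y _ _|c l IH y /= /andP[c0 l0] [fl]].
  by have := frac_itv y; rewrite /cf_tail /=; split; lra.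
have c1 : 1 <= c%:R :> R by rewrite ler1n.
move/(IH _ l0).
have /andP[u0 _] := @cf_tail_itv R l 1 l0 ltac:(lra).
have /andP[v0 _] := @cf_tail_itv R l 0 l0 ltac:(lra).
have /andP[w0 _] := frac_itv (frac y)^-1.
have -> : frac y = (c%:R + frac (frac y)^-1)^-1.
  by rewrite {2}/frac fl -pmulrn addrCA subrr addr0 invrK.
set w := frac (_)^-1 in w0 *; rewrite invrK.
rewrite /cf_tail /= -!/(cf_tail l _) exprS.
have -> : frac (c%:R + w) = w.
  have w1 : w < 1 by case/andP: (frac_itv (frac y)^-1).
  have cw : c%:~R <= c%:R + w < c%:~R + 1 by rewrite -pmulrn; lra.
  by rewrite (fracE cw) -pmulrn; lra.
case: (@invr_sub_signed R c%:R w (cf_tail l 0)); [lra..|move=> D D0 ->].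
case: (@invr_sub_signed R c%:R (cf_tail l 1) w); [lra..|move=> D' D'0 ->].
set e := (-1) ^+ _ => -[] /(mulr_ge0 (ltW D0)) h1 /(mulr_ge0 (ltW D'0)) h2.
split; lra.
Qed.

(** Strictness cannot be dropped: if l ends with 1, then [0; l] does not start
    with l.  Inside the interval, the two endpoints for the tail of l lie in
    [0, 1], so that 1 / frac y - c is in ]0, 1[ and c is the floor of 1 / frac y. *)
Lemma between_cf_starts (R : realType) (l : seq nat) (y : R) :
  all (leq 1) l ->
  0 < (-1) ^+ size l * (frac y - cf_tail l 0) ->
  0 < (-1) ^+ size l * (cf_tail l 1 - frac y) ->
  cf_starts l (frac y)^-1.
Proof.
elim: l y => [//|c l IH y /= /andP[c0 l0]].
have c1 : 1 <= c%:R :> R by rewrite ler1n.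
have /andP[u0 u1] := @cf_tail_itv R l 1 l0 ltac:(lra).
have /andP[v0 v1] := @cf_tail_itv R l 0 l0 ltac:(lra).
have /andP[x0 _] := frac_itv y.
rewrite /cf_tail /= -!/(cf_tail l _) exprS.
have e01 : (-1) ^+ size l = 1 :> R \/ (-1) ^+ size l = - 1 :> R.
  by rewrite -signr_odd; case: odd; rewrite ?expr1 ?expr0; [right|left].
set e := (-1) ^+ _ in e01 *; set x := frac y in x0 *.
set u := cf_tail l 1 in u0 u1 *; set v := cf_tail l 0 in v0 v1 *.
have iu : 0 < (c%:R + u)^-1 by rewrite invr_gt0; lra.
have iv : 0 < (c%:R + v)^-1 by rewrite invr_gt0; lra.
move=> h1 h2.
have {}x0 : 0 < x by case: e01 => ee; rewrite ee in h1 h2; lra.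
pose w := x^-1 - c%:R.
have xE : x = (c%:R + w)^-1 by rewrite /w addrCA subrr addr0 invrK.
have cw : 0 < c%:R + w by rewrite -invr_gt0 -xE.
have h3 : 0 < e * (w - v).
  case: (@invr_sub_signed R c%:R w v cw); [lra|move=> D D0 E].
  rewrite -(pmulr_rgt0 _ D0); move: h1; rewrite xE E; lra.
have h4 : 0 < e * (u - w).
  case: (@invr_sub_signed R c%:R u w _ cw); [lra|move=> D D0 E].
  rewrite -(pmulr_rgt0 _ D0); move: h2; rewrite xE E; lra.
have w01 : 0 < w < 1.
  by apply/andP; case: e01 => ee; rewrite ee in h3 h4; lra.
have cxw : c%:~R <= x^-1 < c%:~R + 1 by rewrite -pmulrn /w in w01 *; lra.
have fw : frac x^-1 = w by rewrite (fracE cxw) -pmulrn.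
split; first by apply: floor_def; rewrite intrD.
by apply: IH; rewrite // fw.
Qed.

Lemma cf_startsP (R : realType) (l : seq nat) (z : R) :
  cf_starts l z <-> forall j, (j < size l)%N -> cf_A z j = (nth 0%N l j)%:Z.
Proof.
have shift y i : cf_Y y i.+1 = cf_Y (frac y)^-1 i :> R.
  by elim: i => //= i <-.
elim: l z => [z|c l IH z]; first by split.
split=> [[h /IH h'] [|j]|h]; first by [].
  by move=> jl; rewrite /cf_A shift; exact: h'.
split; first exact: (h 0%N).
by apply/IH => j jl; have := h j.+1 jl; rewrite /cf_A shift.
Qed.

Lemma cf_coeffsP (R : realType) (k : nat) (a : 'rV[nat]_k) (y : R) :
  cf_coeffs k y = map_mx Posz a <->
  cf_starts [seq a ord0 j | j <- enum 'I_k] (frac y)^-1.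
Proof.
have shift i : cf_Y y i.+1 = cf_Y (frac y)^-1 i :> R by elim: i => //= i ->.
have nthE (j : 'I_k) : nth 0%N [seq a ord0 j | j <- enum 'I_k] j = a ord0 j.
  by rewrite (nth_map j) ?size_enum_ord // nth_ord_enum.
split.
  move=> /rowP h; apply/cf_startsP => j.
  rewrite size_map size_enum_ord => jk; have := h (Ordinal jk).
  by rewrite !mxE /cf_A shift => ->; rewrite -(nthE (Ordinal jk)).
move=> /cf_startsP h; apply/rowP => j; rewrite !mxE /cf_A shift.
by rewrite -nthE; apply: h; rewrite size_map size_enum_ord.
Qed.

Lemma cf_evalE (R : realType) (k : nat) (a : 'rV[nat]_k) :
  cf_eval R a = cf_tail [seq a ord0 j | j <- enum 'I_k] 0.
Proof. by rewrite /cf_eval /cf_tail -map_comp. Qed.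

(** Increasing the last entry by one is the same as adding the tail t = 1. *)
Lemma cf_eval_e_last (R : realType) (k : nat) (a : 'rV[nat]_k) : (1 <= k)%N ->
  cf_eval R (a + e_last k) = cf_tail [seq a ord0 j | j <- enum 'I_k] 1.
Proof.
case: k a => // k a _; rewrite cf_evalE /cf_tail enum_ordSr !map_rcons.
rewrite !foldr_rcons !mxE eqxx natrD addr0; congr foldr; congr map.
rewrite -!map_comp; apply: eq_map => j /=.
by rewrite !mxE /= eqSS ltn_eqF // addr0.
Qed.

(** * The tail of a Pareto variable and of its logarithm *)

Lemma powRN_cvgy (R : realType) (s : R) : 0 < s ->
  x `^ (- s) @[x --> +oo] --> (0 : R).
Proof.
move=> s0.
apply: (@cvg_trans _ ((expR (- (ln x * s))) @[x --> +oo])).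
  apply: near_eq_cvg; near=> x.
  have x0 : 0 < x by near: x; exact: nbhs_pinfty_gt.
  by rewrite /powR gt_eqF// mulNr mulrC.
apply: (@cvg_comp _ _ _ (fun x => ln x * s) (fun x => expR (- x)) _ (@pinfty_nbhs R)).
  apply: gt0_cvgMly => //; apply/cvgryPge => A; near=> x.
  have Ax : expR A <= x by near: x; exact: nbhs_pinfty_ge.
  by rewrite -[A]expRK ler_ln ?posrE ?expR_gt0// (lt_le_trans (expR_gt0 A)).
exact: cvgr_expR.
Unshelve. all: by end_near. Qed.

Lemma is_derive_scaled_powR (R : realType) (c r x : R) : 0 < x ->
  is_derive x 1 (fun y : R => c * y `^ r) (c * (r * x `^ (r - 1))).
Proof. by move=> x0; exact: is_deriveZ (is_derive1_powR r x0). Qed.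

Lemma continuous_scaled_powR (R : realType) (c r x : R) : 0 < x ->
  {for x, continuous (fun y : R => c * y `^ r)}.
Proof.
move=> /(is_derive_scaled_powR c r)[h _].
by apply: differentiable_continuous; apply/derivable1_diffP.
Qed.

(** The primitive is x |-> - xm^s x^(-s), which vanishes at infinity. *)
Lemma integral_pareto_pdf_tail (R : realType) (xm s t : R) :
  0 < xm -> 0 < s -> xm <= t ->
  (\int[lebesgue_measure]_(x in `[t, +oo[) (pareto_pdf xm s x)%:E
   = ((t / xm) `^ (- s))%:E)%E.
Proof.
move=> xm0 s0 xmt; have t0 : 0 < t by exact: lt_le_trans xmt.
transitivity (\int[lebesgue_measure]_(x in `[t, +oo[)
    (s * xm `^ s * x `^ (- s - 1))%:E)%E.
  apply: eq_integral => x; rewrite inE/= in_itv/= andbT => tx.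
  by rewrite /pareto_pdf (le_trans xmt tx) opprD.
rewrite (@ge0_continuous_FTC2y _ _ (fun x => - (xm `^ s) * x `^ (- s)) t 0).
- rewrite sub0e -EFinN mulNr opprK; congr EFin.
  rewrite powRM ?invr_ge0 1?ltW// mulrC; congr *%R.
  by rewrite -powR_inv1 1?ltW// -powRrM mulN1r opprK.
- by move=> x tx; rewrite !mulr_ge0 ?powR_ge0// ltW.
- apply/continuous_within_itvcyP; split.
    move=> x; rewrite in_itv/= andbT => tx.
    by apply: continuous_scaled_powR; exact: lt_trans tx.
  by apply: cvg_at_right_filter; exact: continuous_scaled_powR.
- rewrite -[X in _ --> X](mulr0 (- xm `^ s)).
  exact: (cvgM (cvg_cst _) (powRN_cvgy s0)).
- move=> x tx; have x0 : 0 < x by exact: lt_trans tx.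
  by case: (is_derive_scaled_powR (- xm `^ s) (- s) x0).
- by apply: cvg_at_right_filter; exact: continuous_scaled_powR.
- move=> x; rewrite in_itv/= andbT => tx.
  have x0 : 0 < x by exact: lt_trans tx.
  rewrite derive1E; case: (is_derive_scaled_powR (- xm `^ s) (- s) x0) => _ ->.
  by ring.
Qed.

(** This passes from events of X to events of log_b X, which agree off the null set
    where X < xm; the junk value of the logarithm at nonpositive reals is hidden
    there. *)
Lemma measure_eq_off_null d (T : measurableType d) (R : realType)
    (mu : {measure set T -> \bar R}) (A B N : set T) :
  measurable A -> measurable B -> measurable N -> mu N = 0%E ->
  (forall w, ~ N w -> A w <-> B w) -> mu A = mu B.
Proof.
move=> mA mB mN N0 AB.
have off C : measurable C -> mu C = mu (C `\` N).
  move=> mC; rewrite (measureDI mu mC mN) [X in (_ + X)%E](_ : _ = 0%E) ?adde0//.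
  by apply: subset_measure0 N0 => //; exact: measurableI.
rewrite (off _ mA) (off _ mB).
by congr (mu _); apply/seteqP; split=> w [/= h n]; split=> //; apply/AB.
Qed.

Lemma pareto_tail d (T : measurableType d) (R : realType)
    (P : probability T R) (X : {RV P >-> R}) (xm s t : R) :
  0 < xm -> 0 < s -> is_pareto X xm s -> xm <= t ->
  P [set w | t <= X w] = ((t / xm) `^ (- s))%:E.
Proof.
move=> xm0 s0 hX xmt; rewrite -(integral_pareto_pdf_tail xm0 s0 xmt).
rewrite -hX// /distribution/= /pushforward; congr (P _).
by apply/seteqP; split=> w /=; rewrite in_itv/= andbT.
Qed.

Lemma pareto_atomless d (T : measurableType d) (R : realType)
    (P : probability T R) (X : {RV P >-> R}) (xm s t : R) :
  is_pareto X xm s -> P [set w | X w = t] = 0%E.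
Proof. by move=> /(_ _ (measurable_set1 t)); rewrite integral_set1. Qed.

Lemma pareto_below d (T : measurableType d) (R : realType)
    (P : probability T R) (X : {RV P >-> R}) (xm s : R) :
  is_pareto X xm s -> P [set w | X w < xm] = 0%E.
Proof.
move=> hX; have -> : [set w | X w < xm] = X @^-1` `]-oo, xm[.
  by apply/seteqP; split=> w /=; rewrite in_itv.
have := hX `]-oo, xm[%classic (measurable_itv _).
rewrite /distribution/= /pushforward => ->.
apply: integral0_eq => x /=; rewrite in_itv/= => xx.
by rewrite /pareto_pdf leNgt xx.
Qed.

Lemma powR_logb (R : realType) (b : nat) (x : R) : (2 <= b)%N -> 0 < x ->
  b%:R `^ logb b x = x.
Proof.
move=> b2 x0; have b1 : 1 < b%:R :> R by rewrite ltr1n.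
rewrite /powR gt_eqF ?(lt_trans _ b1)// /logb divfK ?gt_eqF ?ln_gt0//.
exact: lnK.
Qed.

Lemma le_powR_logb (R : realType) (b : nat) (y x : R) : (2 <= b)%N -> 0 < x ->
  (b%:R `^ y <= x) = (y <= logb b x).
Proof.
move=> b2 x0; have b1 : 1 < b%:R :> R by rewrite ltr1n.
rewrite /logb ler_pdivlMr ?ln_gt0// -ln_powR ler_ln ?posrE//.
by rewrite powR_gt0// (lt_trans _ b1).
Qed.

Lemma measurable_logb (R : realType) (b : nat) :
  measurable_fun [set: R] (@logb R b).
Proof. by apply: measurable_funM => //; exact: measurable_ln. Qed.

(** The survival function of l + E, where E is exponential with rate s ln B. *)
Definition expo_tail (R : realType) (B s l y : R) : R :=
  if y <= l then 1 else B `^ (- s * (y - l)).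

Section pareto_log.
Context d (T : measurableType d) (R : realType) (P : probability T R).
Variables (X : {RV P >-> R}) (b : nat) (xm s : R).
Hypotheses (hb : (2 <= b)%N) (hxm : 0 < xm) (hs : 0 < s).
Hypothesis hX : is_pareto X xm s.

Let B1 : 1 < b%:R :> R. Proof. by rewrite ltr1n. Qed.

Lemma measurable_logb_RV : measurable_fun setT (logb b \o X).
Proof. by apply: measurableT_comp => //; exact: measurable_logb. Qed.

(** Truncating at xm handles at once the y below log_b xm, where the tail is 1,
    and the y above. *)
Lemma pareto_tail_max y :
  P [set w | Num.max (b%:R `^ y) xm <= X w] =
  (expo_tail b%:R s (logb b xm) y)%:E.
Proof.
rewrite (pareto_tail hxm hs hX) ?le_max ?lexx ?orbT//; congr EFin.
rewrite /expo_tail -le_powR_logb//; case: leP => [_|_].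
  by rewrite divff ?gt_eqF// powR1.
rewrite -{1}(powR_logb hb hxm) -powRB; last first.
  by rewrite (@gt_eqF _ _ b%:R) ?implybT// (lt_trans _ B1).
by rewrite -powRrM mulrC.
Qed.

Let mX B : measurable B -> measurable (X @^-1` B).
Proof. by move=> mB; rewrite -[_ @^-1` _]setTI; exact: measurable_funP. Qed.

Let mlog B : measurable B -> measurable ((logb b \o X) @^-1` B).
Proof.
by move=> mB; rewrite -[_ @^-1` _]setTI; exact: measurable_logb_RV.
Qed.

Lemma logb_tail_ge y :
  P [set w | y <= logb b (X w)] = (expo_tail b%:R s (logb b xm) y)%:E.
Proof.
rewrite -pareto_tail_max.
apply: (@measure_eq_off_null _ _ _ _ _ _ [set w | X w < xm]).
- have := mlog (measurable_itv `[y, +oo[); congr measurable.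
  by apply/seteqP; split=> w /=; rewrite in_itv/= andbT.
- have := mX (measurable_itv `[Num.max (b%:R `^ y) xm, +oo[); congr measurable.
  by apply/seteqP; split=> w /=; rewrite in_itv/= andbT.
- exact: mX (measurable_itv `]-oo, xm[).
- exact: pareto_below hX.
- move=> w /= /negP; rewrite -leNgt => xmX.
  by rewrite ge_max xmX andbT le_powR_logb// (lt_le_trans hxm).
Qed.

(** Strict and weak tails agree because X has no atom at b^y. *)
Lemma logb_tail_gt y :
  P [set w | y < logb b (X w)] = (expo_tail b%:R s (logb b xm) y)%:E.
Proof.
rewrite -logb_tail_ge.
have mbelow : measurable [set w | X w < xm].
  exact: mX (measurable_itv `]-oo, xm[).
have matom : measurable [set w | X w = b%:R `^ y].
  exact: mX (measurable_set1 _).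
apply: (@measure_eq_off_null _ _ _ _ _ _
  ([set w | X w < xm] `|` [set w | X w = b%:R `^ y])).
- have := mlog (measurable_itv `]y, +oo[); congr measurable.
  by apply/seteqP; split=> w /=; rewrite in_itv/= andbT.
- have := mlog (measurable_itv `[y, +oo[); congr measurable.
  by apply/seteqP; split=> w /=; rewrite in_itv/= andbT.
- exact: measurableU.
- apply: null_set_setU => //; first exact: pareto_below hX.
  exact: pareto_atomless hX.
- move=> w /= /not_orP[/negP]; rewrite -leNgt => xmX Xy.
  split=> [/ltW//|]; rewrite le_eqVlt => /predU1P[yX|//].
  by case: Xy; rewrite yX powR_logb// (lt_le_trans hxm).
Qed.

End pareto_log.

(** * The law of the fractional part *)

(** Such a set differs from the open interval by at most two points.  This is how
    the event on the coefficients is seen to be measurable. *)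
Lemma measurable_near_itv (R : realType) (x y : R) (A : set R) :
  `]x, y[ `<=` A -> A `<=` `[x, y] -> measurable A.
Proof.
move=> xyA Axy; have -> : A = `]x, y[ `|` (A `&` [set x; y]).
  apply/seteqP; split=> [z Az|z [/xyA//|[]//]].
  have := Axy _ Az; rewrite /= !in_itv/= !le_eqVlt.
  move=> /andP[/predU1P[xz _|xz /predU1P[zy|zy]]].
  - by right; split=> //; left.
  - by right; split=> //; right.
  - by left; rewrite xz zy.
apply: measurableU => //; apply: countable_measurable.
  by move=> t; exact: measurable_set1.
by apply: finite_set_countable; apply: finite_setIr; exact: finite_set2.
Qed.

Section frac_law.
Context d (T : measurableType d) (R : realType) (P : probability T R).
Variables (Y : T -> R) (B s l : R).
Hypotheses (mY : measurable_fun setT Y) (B1 : 1 < B) (s0 : 0 < s).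
Hypothesis Yge : forall y, P [set w | y <= Y w] = (expo_tail B s l y)%:E.
Hypothesis Ygt : forall y, P [set w | y < Y w] = (expo_tail B s l y)%:E.

Let mpre A : measurable A -> measurable (Y @^-1` A).
Proof. by move=> mA; rewrite -[_ @^-1` _]setTI; exact: mY. Qed.

Let mge y : measurable [set w | y <= Y w].
Proof.
have := mpre (measurable_itv `[y, +oo[); congr measurable.
by apply/seteqP; split=> w /=; rewrite in_itv/= andbT.
Qed.

Let mgt y : measurable [set w | y < Y w].
Proof.
have := mpre (measurable_itv `]y, +oo[); congr measurable.
by apply/seteqP; split=> w /=; rewrite in_itv/= andbT.
Qed.

(** Weak and strict tails of Y agree, so the endpoints carry no mass and the
    probability is the same for all the sets squeezed in this way. *)
Lemma prob_near_itv x y (A : set R) : x <= y ->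
  `]x, y[ `<=` A -> A `<=` `[x, y] ->
  P (Y @^-1` A) = (expo_tail B s l x - expo_tail B s l y)%:E.
Proof.
move=> xy xyA Axy; have mA := mpre (measurable_near_itv xyA Axy).
apply/eqP; rewrite eq_le; apply/andP; split.
  rewrite EFinB leeBrDr// -(Ygt y) -(Yge x) -measureU//.
    apply: le_measure; rewrite ?inE//; first exact: measurableU.
    move=> w /= [/Axy|/ltW]; last exact: le_trans.
    by rewrite /= in_itv/= => /andP[].
  rewrite -subset0 => w [/= /Axy]; rewrite /= in_itv/= => /andP[_ h1 h2].
  by move: (le_lt_trans h1 h2); rewrite ltxx.
rewrite EFinB leeBlDr// -(Yge y) -(Ygt x).
apply: (@le_trans _ _ (P (Y @^-1` A `|` [set w | y <= Y w]))); last first.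
  exact: measureU2.
apply: le_measure; rewrite ?inE//; first exact: measurableU.
move=> w /= xw; have [yw|wy] := leP y (Y w); first by right.
by left; apply: xyA; rewrite /= in_itv/= xw.
Qed.

Local Notation rho := (frac l).
Local Notation q := (B `^ (- s)).

Let B0 : 0 < B. Proof. exact: lt_trans B1. Qed.

(** In the cell of l, the tail is constant up to l, that is up to the fractional
    part rho; this truncation is what the unit step expresses. *)
Lemma expo_tail_first z :
  1 - expo_tail B s l ((Num.floor l)%:~R + z) =
  unit_step (z - rho) * (1 - B `^ (- s * (z - rho))).
Proof.
have zl : (Num.floor l)%:~R + z - l = z - rho by rewrite /frac; ring.
rewrite /expo_tail /unit_step zl -subr_le0 zl.
case: (ltgtP (z - rho) 0) => [_|_|->]; rewrite ?mul0r ?mul1r ?subrr//.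
by rewrite mulr0 powRr0 subrr.
Qed.

(** Beyond the cell of l, each unit translation multiplies the tail by B^(-s). *)
Lemma expo_tail_next z n : 0 <= z ->
  expo_tail B s l ((Num.floor l + n.+1)%:~R + z) =
  B `^ (s * (rho - 1)) * B `^ (- s * z) * q ^+ n.
Proof.
move=> z0; have /andP[_ r1] := frac_itv l.
have n0 : 0 <= n%:R :> R by [].
have zl : (Num.floor l + n.+1)%:~R + z - l = n%:R + z + (1 - rho).
  by rewrite intrD -pmulrn -natr1 /frac; ring.
have pos : 0 < n%:R + z + (1 - rho) by lra.
rewrite /expo_tail -subr_le0 zl leNgt pos /=.
rewrite -powR_mulrn ?powR_ge0// -powRrM -!powRD ?(gt_eqF B0) ?implybT//.
by congr (_ `^ _); ring.
Qed.

Let powRs1 : 0 < q < 1.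
Proof.
rewrite powR_gt0//= powRN invf_lt1 ?powR_gt0//.
rewrite -[X in X < _](powRr0 B) /powR !gt_eqF// ltr_expR mul0r.
by rewrite mulr_gt0// ln_gt0.
Qed.

(** The probability is the sum over n of that of the cells floor l + n: the term
    n = 0 is given by expo_tail_first, and the others form a geometric series by
    expo_tail_next. *)
Lemma prob_frac_near_itv (A : set R) (lo hi : R) :
  0 <= lo -> lo <= hi -> hi <= 1 ->
  (forall y, A y -> lo <= frac y <= hi) ->
  (forall y, lo < frac y < hi -> A y) ->
  P (Y @^-1` A) =
  (B `^ (s * (rho - 1)) *
      ((B `^ (- s * lo) - B `^ (- s * hi)) / (1 - q))
   + unit_step (hi - rho) * (1 - B `^ (- s * (hi - rho)))
   - unit_step (lo - rho) * (1 - B `^ (- s * (lo - rho))))%:E.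
Proof.
move=> lo0 lohi hi1 Ahull Aint.
pose slice (z : int) : set R := A `&` `[z%:~R, z%:~R + 1[.
have sliceI z : `]z%:~R + lo, z%:~R + hi[ `<=` slice z.
  move=> y; rewrite /slice /= !in_itv/= => /andP[yl yh].
  have yz : z%:~R <= y < z%:~R + 1 by apply/andP; lra.
  by split=> //; apply: Aint; rewrite (fracE yz); lra.
have sliceS z : slice z `<=` `[z%:~R + lo, z%:~R + hi].
  move=> y; rewrite /slice /= !in_itv/= => -[/Ahull + yz].
  by rewrite (fracE yz); lra.
have mslice z : measurable (slice z) by exact: measurable_near_itv.
have sliceT y : A y -> slice (Num.floor y) y.
  by split=> //=; rewrite in_itv/= -[X in _ + X]/(1%:~R) -intrD floor_itv.
have sliceF z y : slice z y -> Num.floor y = z.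
  by case=> _ /=; rewrite in_itv/= => yz; apply: floor_def; rewrite intrD.
have mA : measurable A.
  have -> : A = \bigcup_z slice z.
    by apply/seteqP; split=> [y /sliceT ?|y [z _ []]//]; exists (Num.floor y).
  exact: countable_bigcupT_measurable.
have Pslice z : P (Y @^-1` slice z) =
    (expo_tail B s l (z%:~R + lo) - expo_tail B s l (z%:~R + hi))%:E.
  by apply: prob_near_itv => //; rewrite lerD2l.
pose F n := Y @^-1` slice (Num.floor l + n%:Z).
have mF n : measurable (F n) by exact: mpre.
(* Y is almost surely at least l, hence in a cell of index at least floor l. *)
have below0 : P (~` [set w | (Num.floor l)%:~R <= Y w]) = 0%E.
  by rewrite probability_setC// Yge /expo_tail floor_le subee.
have PA : P (Y @^-1` A) = P (\bigcup_n F n).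
  apply: (@measure_eq_off_null _ _ _ _ _ _ (~` [set w | (Num.floor l)%:~R <= Y w])).
  - exact: mpre.
  - exact: bigcupT_measurable.
  - exact: measurableC.
  - exact: below0.
  - move=> w /= /contrapT lY; split=> [/sliceT Aw|[n _ []//]].
    have := lY; rewrite -floor_ge_int => fY.
    exists `|Num.floor (Y w) - Num.floor l|%N => //; rewrite /F /=.
    by rewrite gez0_abs ?subr_ge0// subrKC.
have tF : trivIset setT F.
  apply/trivIsetP => i j _ _ /eqP ij; rewrite -subset0 => w [/sliceF wi /sliceF].
  by rewrite wi => /addrI[].
pose c0 := unit_step (hi - rho) * (1 - B `^ (- s * (hi - rho)))
  - unit_step (lo - rho) * (1 - B `^ (- s * (lo - rho))).
pose c1 := B `^ (s * (rho - 1)) * (B `^ (- s * lo) - B `^ (- s * hi)).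
have PF0 : P (F 0%N) = c0%:E.
  by rewrite Pslice addr0 /c0 -!expo_tail_first; congr EFin; ring.
have PFS n : P (F n.+1) = (geometric c1 q n)%:E.
  rewrite Pslice !expo_tail_next//; last exact: le_trans lohi.
  by congr EFin; rewrite /c1 /=; ring.
have cvgP : (fun n => (\sum_(0 <= i < n) P (F i))%E) @ \oo --> P (\bigcup_n F n).
  by apply: measure_semi_sigma_additive => //; exact: bigcupT_measurable.
have cvgS : (fun n => c0 + series (geometric c1 q) n) @ \oo --> c0 + c1 / (1 - q).
  apply: cvgD; first exact: cvg_cst.
  have /andP[q0 q1] := powRs1.
  by apply: cvg_geometric_series; rewrite ger0_norm// ltW.
transitivity (c0 + c1 / (1 - q))%:E; last first.
  by congr EFin; rewrite /c0 /c1; ring.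
rewrite PA -(cvg_lim _ cvgP)//; apply: cvg_lim => //.
(* Shift the partial sums by one to split off the cell n = 0. *)
rewrite -cvg_shiftS.
have -> : [sequence (\sum_(0 <= i < n.+1) P (F i))%E]_n =
    EFin \o (fun n => c0 + series (geometric c1 q) n).
  apply/funext => n; rewrite [LHS]big_nat_recl//= [RHS]EFinD PF0; congr (_ + _)%E.
  by rewrite /series/= -sumEFin; apply: eq_bigr => i _; exact: PFS.
by apply: cvg_EFin; [near=> n | exact: cvgS].
Unshelve. all: by end_near. Qed.

End frac_law.

(** * The probability of a cylinder *)

Theorem mainTheorem9 (R : realType) (d : measure_display) (T : measurableType d)
  (P : probability T R) (X : {RV P >-> R}) (b : nat) (xm s : R)
  (hb : (2 <= b)%N) (hxm : 0 < xm) (hs : 0 < s) (hX : is_pareto X xm s)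
  (k : nat) (hk : (1 <= k)%N) (a : 'rV[nat]_k)
  (ha : forall j : 'I_k, (0 < a ord0 j)%N) :
  let rho : R := frac (logb b xm) in
  let c : R := cf_eval R a in
  let c' : R := cf_eval R (a + e_last k) in
  let B : R := b%:R in
  P [set w | cf_coeffs k (logb b (X w)) = map_mx Posz a] =
  ((-1) ^+ k *
    (B `^ (s * (rho - 1)) *
        ((B `^ (- s * c) - B `^ (- s * c')) / (1 - B `^ (- s)))
     + unit_step (c' - rho) * (1 - B `^ (- s * (c' - rho)))
     - unit_step (c - rho) * (1 - B `^ (- s * (c - rho)))))%:E.
Proof.
move=> rho c c' B.
set l := [seq a ord0 j | j <- enum 'I_k].
have lpos : all (leq 1) l by apply/allP => _ /mapP[j _ ->]; exact: ha.
have size_l : size l = k by rewrite size_map size_enum_ord.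
have cE : c = cf_tail l 0 by exact: cf_evalE.
have c'E : c' = cf_tail l 1 by exact: cf_eval_e_last.
have c01 : 0 <= c <= 1 by rewrite cE cf_tail_itv//; lra.
have c'01 : 0 <= c' <= 1 by rewrite c'E cf_tail_itv//; lra.
have := @cf_tail_order R l lpos; rewrite -c'E -cE size_l => cc'.
pose A := [set y : R | cf_coeffs k y = map_mx Posz a].
have Ahull y : A y ->
    0 <= (-1) ^+ k * (frac y - c) /\ 0 <= (-1) ^+ k * (c' - frac y).
  by move=> /cf_coeffsP /(cf_starts_between lpos); rewrite size_l -c'E -cE.
have Aint y : 0 < (-1) ^+ k * (frac y - c) -> 0 < (-1) ^+ k * (c' - frac y) -> A y.
  move=> h1 h2; apply/cf_coeffsP; apply: between_cf_starts => //.
    by rewrite size_l -cE.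
  by rewrite size_l -c'E.
have key := prob_frac_near_itv (measurable_logb_RV X b) _ hs
  (logb_tail_ge hb hxm hs hX) (logb_tail_gt hb hxm hs hX).
have B1 : 1 < B by rewrite ltr1n.
change (P ((logb b \o X) @^-1` A) = ((-1) ^+ k *
  (B `^ (s * (rho - 1)) * ((B `^ (- s * c) - B `^ (- s * c')) / (1 - B `^ (- s)))
   + unit_step (c' - rho) * (1 - B `^ (- s * (c' - rho)))
   - unit_step (c - rho) * (1 - B `^ (- s * (c - rho)))))%:E).
(* For odd k the endpoints are exchanged, which changes the sign of the formula. *)
rewrite -signr_odd in cc' Ahull Aint *; case: odd cc' Ahull Aint => cc' Ahull Aint.
- rewrite expr1 in cc' Ahull Aint *; rewrite (key B1 A c' c); first last.
  + by move=> y cyc; apply: Aint; lra.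
  + by move=> y /Ahull[]; lra.
  + by lra.
  + by lra.
  + by lra.
  + by congr EFin; rewrite -/rho; ring.
- rewrite expr0 in cc' Ahull Aint *; rewrite (key B1 A c c'); first last.
  + by move=> y cyc; apply: Aint; lra.
  + by move=> y /Ahull[]; lra.
  + by lra.
  + by lra.
  + by lra.
  + by rewrite mul1r.
Qed.
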